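(* The category $\mathtt{Alg}(\mathsf{As})$ of algebras over the non-symmetric operad $\mathsf{As}$ is isomorphic (as a category) to the category $\mathtt{Alg}_{\mathbb K}$ of (not necessarily unital) associative $\mathbb K$-algebras. More precisely, the functor $F:\mathtt{Alg}(\mathsf{As})\to\mathtt{Alg}_{\mathbb K}$ given by $F(V,\Phi)=(V,\Phi_2(\mu_2))$ on objects and $F(f)=f$ on morphisms, and the functor $G:\mathtt{Alg}_{\mathbb K}\to\mathtt{Alg}(\mathsf{As})$ given by $G(A,m_A)=(A,\Psi)$ on objects, with $\Psi$ the $\mathsf{As}$-algebra structure induced by $m_A$, and $G(g)=g$ on morphisms, establish this isomorphism of categories.
   Context: $\mathbb K$ is a field of characteristic $0$; vector spaces, linear maps and tensor products are over $\mathbb K$. A (linear) non-symmetric operad $\mathcal P$ consists of vector spaces $\mathcal P(n)$, $n\ge 0$, linear composition maps $\mathcal P(n)\otimes\mathcal P(k_1)\otimes\cdots\otimes\mathcal P(k_n)\to\mathcal P(k_1+\cdots+k_n)$, written $\theta\otimes\theta_1\otimes\cdots\otimes\theta_n\mapsto\theta\circ(\theta_1,\dots,\theta_n)$, for all $n,k_i\ge 0$, and a unit $1\in\mathcal P(1)$, such that $\theta\circ(\theta_1\circ(\theta_{1,1},\dots,\theta_{1,k_1}),\dots,\theta_n\circ(\theta_{n,1},\dots,\theta_{n,k_n}))=(\theta\circ(\theta_1,\dots,\theta_n))\circ(\theta_{1,1},\dots,\theta_{n,k_n})$ and $\theta\circ(1,\dots,1)=\theta=1\circ\theta$. For a vector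 space $V$, $\mathrm{End}_V(n)=\mathrm{Hom}(V^{\otimes n},V)$ (with $V^{\otimes 0}=\mathbb K$), with composition $f\circ(f_1\otimes\cdots\otimes f_n)$ of multilinear maps and unit $\mathrm{id}_V$. A $\mathcal P$-algebra is a pair $(V,\Phi)$ with $V$ a vector space and $\Phi=\{\Phi_n:\mathcal P(n)\to\mathrm{End}_V(n)\}_{n\ge0}$ a family of linear maps preserving composition and unit. A morphism $(V,\Phi^V)\to(W,\Phi^W)$ of $\mathcal P$-algebras is a linear map $f:V\to W$ with $f\circ\Phi^V_n(\mu)=\Phi^W_n(\mu)\circ f^{\otimes n}$ for all $n\ge0$ and $\mu\in\mathcal P(n)$. These form the category $\mathtt{Alg}(\mathcal P)$. The operad $\mathsf{As}$: $\mathsf{As}(0)=0$, $\mathsf{As}(n)=\mathbb K\{\mu_n\}$ one-dimensional with basis element $\mu_n$ for $n\ge1$, composition determined by $\mu_n\circ(\mu_{k_1},\dots,\mu_{k_n})=\mu_{k_1+\cdots+k_n}$ for $n,k_i\ge1$ (compositions involving $\mathsf{As}(0)=0$ are zero), unit $\mu_1$. An associative $\mathbb K$-algebra $(A,m_A)$ is a vector space with an associative bilinear product, no unit required; morphisms are linear maps preserving products. The induced structure $\Psi$: $\Psi_0=0$, $\Psi_1(\mu_1)=\mathrm{id}_A$, $\Psi_2(\mu_2)=m_A$, and $\Psi_n(\mu_n)=\Psi_2(\mu_2)\circ(\Psi_{n-1}(\mu_{n-1})\otimes\Psi_1(\mu_1))$ for $n\ge3$. *)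

(* Defs.v *)
From HB Require Import structures.
From mathcomp Require Import all_boot all_order all_algebra.
From mathcomp Require Import boolp functions.

Set Implicit Arguments.
Unset Strict Implicit.
Unset Printing Implicit Defensive.

Import GRing.Theory.
Local Open Scope ring_scope.

Record category := Category {
  obj :> Type;
  hom : obj -> obj -> Type;
  idm : forall X, hom X X;
  comp : forall X Y Z, hom Y Z -> hom X Y -> hom X Z;
  comp1m : forall X Y (f : hom X Y), comp (idm Y) f = f;
  compm1 : forall X Y (f : hom X Y), comp f (idm X) = f;
  compmA : forall X Y Z T (h : hom Z T) (g : hom Y Z) (f : hom X Y),
    comp h (comp g f) = comp (comp h g) f
}.

Arguments hom {c} X Y.
Arguments idm {c} X.
Arguments comp {c X Y Z} g f : rename.

Record functor (C D : category) := Functor {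
  fobj :> C -> D;
  fmap : forall X Y : C, hom X Y -> hom (fobj X) (fobj Y);
  fmap1 : forall X, fmap (idm X) = idm (fobj X);
  fmapM : forall X Y Z (g : hom Y Z) (f : hom X Y),
    fmap (comp g f) = comp (fmap g) (fmap f)
}.

Arguments fmap {C D} F {X Y} f : rename.

Definition functor_id (C : category) : functor C C :=
  @Functor C C id (fun X Y => id) (fun X => erefl) (fun X Y Z g f => erefl).

Fact functor_comp1 (C D E : category) (G : functor D E) (F : functor C D) X :
  fmap G (fmap F (idm X)) = idm (G (F X)).
Proof. by rewrite !fmap1. Qed.

Fact functor_compM (C D E : category) (G : functor D E) (F : functor C D)
    X Y Z (g : hom Y Z) (f : hom X Y) :
  fmap G (fmap F (comp g f)) = comp (fmap G (fmap F g)) (fmap G (fmap F f)).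
Proof. by rewrite !fmapM. Qed.

Definition functor_comp (C D E : category)
    (G : functor D E) (F : functor C D) : functor C E :=
  Functor (functor_comp1 G F) (functor_compM G F).

Definition inverse_functors (C D : category)
    (F : functor C D) (G : functor D C) : Prop :=
  functor_comp G F = functor_id C /\ functor_comp F G = functor_id D.

(* A linear map from a tensor product is encoded as a multilinear map on    *)
(* families [forall i, V i]: [dfwith v x] is [v] with its i-th entry        *)
(* replaced by [x : V i].                                                   *)
Definition multilinear (K : fieldType) (I : eqType) (V : I -> lmodType K)
    (W : lmodType K) (f : (forall i, V i) -> W) : Prop :=
  forall (v : forall i, V i) (i : I),
    linear (fun x : V i => f (eqtype.dfwith v x)).

(* [Endo V n] is Hom(V^(x) n, V); [Endo V 0] is a copy of V since           *)
(* ['I_0 -> V] has exactly one element.                                     *)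
Section Endo.
Variables (K : fieldType) (V : lmodType K) (n : nat).

Definition multilinear_pred : {pred ('I_n -> V) -> V} :=
  fun f => `[< multilinear (V := fun=> V) f >].

Record Endo := MkEndo {
  Endo_fun :> ('I_n -> V) -> V;
  Endo_multilinear : multilinear_pred Endo_fun
}.

HB.instance Definition _ := [isSub for Endo_fun].
HB.instance Definition _ := [Choice of Endo by <:].

Fact multilinear_submod_closed : submod_closed multilinear_pred.
Proof.
split=> [|a f g /asboolP fP /asboolP gP]; apply/asboolP.
  by move=> v i b x y; rewrite /= scaler0 addr0.
move=> v i b x y; set u := eqtype.dfwith v.
change (a *: f (u i (b *: x + y)) + g (u i (b *: x + y)) =
  b *: (a *: f (u i x) + g (u i x)) + (a *: f (u i y) + g (u i y))).
rewrite /u (fP v i) (gP v i).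
rewrite !scalerDr !scalerA [b * a]mulrC -!addrA; congr (_ + _).
by rewrite addrCA.
Qed.

HB.instance Definition _ := GRing.isSubmodClosed.Build K (('I_n -> V) -> V)
  multilinear_pred multilinear_submod_closed.
HB.instance Definition _ := [SubChoice_isSubLmodule of Endo by <:].

End Endo.

Section EndoComposition.
Variables (K : fieldType) (V : lmodType K).

(* The n-ary map f is fed the values of the g_i on the consecutive blocks   *)
(* of length k_i of the arguments: [tagnat.Rank i j] is the position        *)
(* k_0 + ... + k_(i-1) + j.                                                 *)
Definition endo_comp_fun n (k : 'I_n -> nat) (f : Endo V n)
    (g : forall i, Endo V (k i)) (v : 'I_(\sum_i k i) -> V) : V :=
  f (fun i => g i (fun j => v (tagnat.Rank i j))).

Fact endo_comp_multilinear n (k : 'I_n -> nat) (f : Endo V n)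
    (g : forall i, Endo V (k i)) :
  `[< multilinear (V := fun=> V) (endo_comp_fun f g) >].
Proof.
apply/asboolP => v s a x y; rewrite -[s]tagnat.sig2K.
set i := tagnat.sig1 s; set j := tagnat.sig2 s.
have E z : endo_comp_fun f g
    (@eqtype.dfwith _ (fun=> V) v (tagnat.Rank i j) z) =
    f (@eqtype.dfwith _ (fun=> V) (fun i => g i (fun j => v (tagnat.Rank i j)))
      i (g i (@eqtype.dfwith _ (fun=> V) (fun j => v (tagnat.Rank i j)) j z))).
  congr (Endo_fun f _); apply/funext => i'.
  case: eqtype.dfwithP => [|i'' ni].
    congr (Endo_fun (g i) _); apply/funext => j'.
    case: (eqVneq j j') => [<-|nj]; first by rewrite !eqtype.dfwith_in.
    by rewrite !eqtype.dfwith_out// -val_eqE /= tagnat.eq_Rank eqxx.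
  congr (Endo_fun (g _) _); apply/funext => j'.
  by rewrite eqtype.dfwith_out// -val_eqE /= tagnat.eq_Rank negb_and ni.
rewrite !E.
have /asboolP gP := Endo_multilinear (g i).
have /asboolP fP := Endo_multilinear f.
by rewrite (gP _ j) (fP _ i).
Qed.

Definition endo_comp n (k : 'I_n -> nat) (f : Endo V n)
    (g : forall i, Endo V (k i)) : Endo V (\sum_i k i) :=
  MkEndo (endo_comp_multilinear f g).

Fact endo_unit_multilinear :
  `[< multilinear (V := fun=> V) (fun v : 'I_1 -> V => v ord0) >].
Proof.
by apply/asboolP => v i a x y; rewrite (ord1 i) !eqtype.dfwith_in.
Qed.

Definition endo_unit : Endo V 1 := MkEndo endo_unit_multilinear.

End EndoComposition.

(* Elements of different arities are compared in the total space of the     *)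
(* family: [Tagged P x = Tagged P y] says that the arities are equal and    *)
(* that x and y are equal along this equality. [tagnat.sig1 s] and          *)
(* [tagnat.sig2 s] are the block containing the position s and the position *)
(* of s in this block.                                                      *)
Record operad (K : fieldType) := Operad {
  op_space :> nat -> lmodType K;
  op_comp : forall n (k : 'I_n -> nat),
    op_space n -> (forall i, op_space (k i)) -> op_space (\sum_i k i);
  op_unit : op_space 1;
  op_comp_linear : forall n (k : 'I_n -> nat) (ths : forall i, op_space (k i)),
    linear (fun th => @op_comp n k th ths);
  op_comp_multilinear : forall n (k : 'I_n -> nat) (th : op_space n),
    multilinear (V := fun i => op_space (k i)) (@op_comp n k th);
  op_compA : forall n (k : 'I_n -> nat) (l : forall i, 'I_(k i) -> nat)
      (th : op_space n) (ths : forall i, op_space (k i))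
      (thss : forall i j, op_space (l i j)),
    Tagged op_space (op_comp th (fun i => op_comp (ths i) (thss i))) =
    Tagged op_space
      (op_comp (op_comp th ths)
               (fun s => thss (tagnat.sig1 s) (tagnat.sig2 s)));
  op_comp1r : forall n (th : op_space n),
    Tagged op_space (op_comp th (fun=> op_unit)) = Tagged op_space th;
  op_comp1l : forall n (th : op_space n),
    Tagged op_space (op_comp (k := fun=> n) op_unit (fun=> th)) =
    Tagged op_space th
}.

Arguments op_unit {K} P : rename.
Arguments op_comp {K} P {n k} th ths : rename.

Section LinearMaps.
Variable K : fieldType.

Lemma linear_map_ext (V W : lmodType K) (f g : {linear V -> W}) :
  (f : V -> W) = g -> f = g.
Proof.
case: f g => [f [[f1] [f2]]] [g [[g1] [g2]]] /= E; subst g.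
by rewrite (Prop_irrelevance f1 g1) (Prop_irrelevance f2 g2).
Qed.

(* An equality of arrows contains equalities of sources and of targets.     *)
Record linear_arrow := LinearArrow {
  arrow_src : lmodType K;
  arrow_tgt : lmodType K;
  arrow_map : {linear arrow_src -> arrow_tgt}
}.

End LinearMaps.

Section OperadAlgebras.
Variables (K : fieldType) (P : operad K).

Record palg_data := PAlgData {
  palg_space :> lmodType K;
  palg_act : forall n, {linear P n -> Endo palg_space n}
}.

Arguments palg_act : clear implicits.

Record is_palg (X : palg_data) : Prop := IsPAlg {
  palg_actM : forall n (k : 'I_n -> nat) (th : P n) (ths : forall i, P (k i)),
    palg_act X _ (op_comp P th ths) =
    endo_comp (palg_act X n th) (fun i => palg_act X (k i) (ths i));
  palg_act1 : palg_act X 1 (op_unit P) = endo_unit X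
}.

Record palg := PAlg {
  palg_of :> palg_data;
  palgP : is_palg palg_of
}.

Record palg_hom (X Y : palg) := PAlgHom {
  palg_map :> {linear X -> Y};
  palg_mapP : forall n (mu : P n) (v : 'I_n -> X),
    palg_map (palg_act X n mu v) = palg_act Y n mu (fun i => palg_map (v i))
}.

Lemma palg_hom_ext (X Y : palg) (f g : palg_hom X Y) :
  (f : X -> Y) = g -> f = g.
Proof.
case: f g => [f fP] [g gP] /= /linear_map_ext E; subst g.
by rewrite (Prop_irrelevance fP gP).
Qed.

Definition palg_id (X : palg) : palg_hom X X :=
  @PAlgHom X X idfun (fun n mu v => erefl).

Fact palg_compP (X Y Z : palg) (g : palg_hom Y Z) (f : palg_hom X Y)
    n (mu : P n) (v : 'I_n -> X) :
  (g \o f) (palg_act X n mu v) = palg_act Z n mu (fun i => (g \o f) (v i)).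
Proof. by rewrite /= !palg_mapP. Qed.

Definition palg_comp (X Y Z : palg) (g : palg_hom Y Z) (f : palg_hom X Y) :
  palg_hom X Z := @PAlgHom X Z (g \o f) (palg_compP g f).

Definition Alg : category.
Proof.
apply: (@Category palg palg_hom palg_id palg_comp).
- by move=> X Y f; apply: palg_hom_ext.
- by move=> X Y f; apply: palg_hom_ext.
- by move=> X Y Z T h g f; apply: palg_hom_ext.
Defined.

End OperadAlgebras.

Arguments palg_act {K P} X n : rename.

Section AssociativeAlgebras.
Variable K : fieldType.

Record assoc_data := AssocData {
  assoc_space :> lmodType K;
  assoc_mul : assoc_space -> assoc_space -> assoc_space
}.

Record is_assoc (A : assoc_data) : Prop := IsAssoc {
  assoc_mul_bilinear : bilinear_for *:%R *:%R (@assoc_mul A);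
  assoc_mulA : associative (@assoc_mul A)
}.

Record assoc_alg := AssocAlg {
  assoc_of :> assoc_data;
  assocP : is_assoc assoc_of
}.

Record assoc_hom (A B : assoc_alg) := AssocHom {
  assoc_map :> {linear A -> B};
  assoc_mapP : {morph assoc_map : x y / assoc_mul x y}
}.

Lemma assoc_hom_ext (A B : assoc_alg) (f g : assoc_hom A B) :
  (f : A -> B) = g -> f = g.
Proof.
case: f g => [f fP] [g gP] /= /linear_map_ext E; subst g.
by rewrite (Prop_irrelevance fP gP).
Qed.

Definition assoc_id (A : assoc_alg) : assoc_hom A A :=
  @AssocHom A A idfun (fun x y => erefl).

Fact assoc_compP (A B C : assoc_alg) (g : assoc_hom B C) (f : assoc_hom A B) :
  {morph g \o f : x y / assoc_mul x y}.
Proof. by move=> x y; rewrite /= !assoc_mapP. Qed.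

Definition assoc_comp (A B C : assoc_alg) (g : assoc_hom B C)
  (f : assoc_hom A B) : assoc_hom A C := @AssocHom A C (g \o f) (assoc_compP g f).

Definition AssocAlgebras : category.
Proof.
apply: (@Category assoc_alg assoc_hom assoc_id assoc_comp).
- by move=> X Y f; apply: assoc_hom_ext.
- by move=> X Y f; apply: assoc_hom_ext.
- by move=> X Y Z T h g f; apply: assoc_hom_ext.
Defined.

End AssociativeAlgebras.

(* As(n) is the space of row vectors of length 1 if n > 0, and 0 if n = 0,  *)
(* where [0 < n] is read as a natural number; [as_coef x] is the coordinate *)
(* of x on mu_n, and is 0 in arity 0, so that compositions involving As(0)  *)
(* vanish.                                                                  *)
Section AsOperad.
Variable K : fieldType.

Definition as_space (n : nat) : lmodType K := 'rV[K]_(0 < n)%N.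

Definition as_mu (n : nat) : as_space n := const_mx 1.

Definition as_coef n (x : as_space n) : K := \sum_j (x : 'rV[K]__) ord0 j.

Definition as_comp n (k : 'I_n -> nat) (th : as_space n)
    (ths : forall i, as_space (k i)) : as_space (\sum_i k i) :=
  (as_coef th * \prod_i as_coef (ths i)) *: as_mu (\sum_i k i).

Fact as_coef_linear n : linear_for *%R (@as_coef n).
Proof.
move=> a x y; rewrite /as_coef mulr_sumr -big_split /=.
by apply: eq_bigr => j _; rewrite !mxE.
Qed.

HB.instance Definition _ n := GRing.isLinear.Build K (as_space n) K *%R
  (@as_coef n) (@as_coef_linear n).

Lemma as_coef_mu n : as_coef (as_mu n) = (0 < n)%:R.
Proof.
rewrite /as_coef (eq_bigr (fun=> 1)); last by move=> j _; rewrite mxE.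
by rewrite sumr_const card_ord.
Qed.

Lemma as_coefK n (x : as_space n) : as_coef x *: as_mu n = x.
Proof.
case: n x => [|n] x; apply/matrixP => i j; first by case: j.
by rewrite (ord1 i) !mxE mulr1 /as_coef big_ord1 (ord1 j).
Qed.

Lemma as_coef0 n (x : as_space n) : n = 0%N -> as_coef x = 0.
Proof. by case: n x => // x _; rewrite /as_coef big_ord0. Qed.

Lemma as_coef_comp n (k : 'I_n -> nat) (th : as_space n)
    (ths : forall i, as_space (k i)) :
  as_coef (as_comp th ths) = as_coef th * \prod_i as_coef (ths i).
Proof.
rewrite linearZ /= as_coef_mu; case: posnP => [k0|_]; last by rewrite mulr1.
rewrite mulr0; case: n k th ths k0 => [|n] k th ths k0.
  by rewrite as_coef0 ?mul0r.
rewrite (bigD1 ord0) //= (@as_coef0 (k ord0)) ?mul0r ?mulr0 //.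
by apply/eqP; rewrite -leqn0 -k0 (bigD1 ord0) //= leq_addr.
Qed.

Lemma as_comp_mu n (k : 'I_n -> nat) :
  (0 < n)%N -> (forall i, (0 < k i)%N) ->
  as_comp (as_mu n) (fun i => as_mu (k i)) = as_mu (\sum_i k i).
Proof.
move=> n0 k0; rewrite /as_comp as_coef_mu n0 mul1r [X in X *: _]big1 ?scale1r // => i _.
by rewrite as_coef_mu k0.
Qed.

Lemma as_Tagged m n (x : as_space m) (y : as_space n) :
  m = n -> as_coef x = as_coef y -> Tagged as_space x = Tagged as_space y.
Proof.
by move=> E; case: _ / E y => y xy; rewrite -[x]as_coefK xy as_coefK.
Qed.

Lemma big_tagnat (R : Type) (idx : R) (op : Monoid.com_law idx)
    n (k : 'I_n -> nat) (F : forall i, 'I_(k i) -> R) :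
  \big[op/idx]_(s < \sum_i k i) F (tagnat.sig1 s) (tagnat.sig2 s) =
  \big[op/idx]_i \big[op/idx]_j F i j.
Proof.
rewrite (sig_big_dep _ _ (fun i j => F i j)) /=.
by rewrite (reindex _ (onW_bij _ (@tagnat.sig_bij n k))).
Qed.

Fact as_comp_linear n (k : 'I_n -> nat) (ths : forall i, as_space (k i)) :
  linear (fun th : as_space n => as_comp th ths).
Proof.
move=> a x y; rewrite /as_comp linearP /= mulrDl scalerDl scalerA.
by rewrite mulrA.
Qed.

Fact as_comp_multilinear n (k : 'I_n -> nat) (th : as_space n) :
  multilinear (V := fun i => as_space (k i)) (@as_comp n k th).
Proof.
move=> v i a x y; rewrite /as_comp.
have E z : \prod_j as_coef (@eqtype.dfwith _ (fun i => as_space (k i)) v i z j)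
    = as_coef z * \prod_(j | j != i) as_coef (v j).
  rewrite (bigD1 i) //= eqtype.dfwith_in; congr (_ * _).
  by apply: eq_bigr => j ji; rewrite eqtype.dfwith_out // eq_sym.
by rewrite !E linearP /= mulrDl mulrDr scalerDl scalerA -mulrA mulrCA.
Qed.

Fact as_compA n (k : 'I_n -> nat) (l : forall i, 'I_(k i) -> nat)
    (th : as_space n) (ths : forall i, as_space (k i))
    (thss : forall i j, as_space (l i j)) :
  Tagged as_space (as_comp th (fun i => as_comp (ths i) (thss i))) =
  Tagged as_space
    (as_comp (as_comp th ths)
             (fun s => thss (tagnat.sig1 s) (tagnat.sig2 s))).
Proof.
apply: as_Tagged; first by rewrite (big_tagnat _ l).
rewrite !as_coef_comp (big_tagnat _ (fun i j => as_coef (thss i j))) /=.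
rewrite -mulrA -big_split /=; congr (_ * _).
by apply: eq_bigr => i _; rewrite as_coef_comp.
Qed.

Fact as_comp1r n (th : as_space n) :
  Tagged as_space (as_comp th (fun=> as_mu 1)) = Tagged as_space th.
Proof.
apply: as_Tagged; first by rewrite sum1_card card_ord.
by rewrite as_coef_comp big1 ?mulr1 // => i _; rewrite as_coef_mu.
Qed.

Fact as_comp1l n (th : as_space n) :
  Tagged as_space (as_comp (k := fun=> n) (as_mu 1) (fun=> th)) =
  Tagged as_space th.
Proof.
apply: as_Tagged; first by rewrite big_ord1.
by rewrite as_coef_comp as_coef_mu big_ord1 mul1r.
Qed.

Definition As : operad K :=
  Operad as_comp_linear as_comp_multilinear as_compA as_comp1r as_comp1l.

End AsOperad.

(* The product m(x, y) = f(x (x) y) of an element f of End_V(2).            *)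
Definition endo_mul (K : fieldType) (V : lmodType K) (f : Endo V 2) (x y : V) :
  V := f (tnth [tuple x; y]).

Section InducedStructure.
Variables (K : fieldType) (A : assoc_alg K).

(* Psi_n(mu_n), evaluated at v; in arity 0, mu_0 = 0. The last branch is    *)
(* Psi_2(mu_2) o (Psi_(n-1)(mu_(n-1)) (x) Psi_1(mu_1)) for n = m + 1.       *)
Fixpoint psi_mu (n : nat) : ('I_n -> A) -> A :=
  match n with
  | 0 => fun=> 0
  | m.+1 => fun v =>
      if m is 0 then v ord_max
      else assoc_mul (psi_mu (fun i => v (widen_ord (leqnSn m) i))) (v ord_max)
  end.

Fact psi_mu_multilinear n : multilinear_pred (@psi_mu n).
Proof.
apply/asboolP; elim: n => [|[|n] IHn] v i a x y.
- by case: i.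
- by rewrite /= (ord1 i) (ord1 ord_max) !eqtype.dfwith_in.
have [[blin blin'] _] := assocP A.
pose w (i : 'I_n.+1) := widen_ord (leqnSn n.+1) i.
have S (u : 'I_n.+2 -> A) : psi_mu u =
  assoc_mul (psi_mu (fun i => u (w i))) (u ord_max) by [].
have [->|ni] := eqVneq i ord_max.
  have E z : psi_mu (fun j => @eqtype.dfwith _ (fun=> A : lmodType K)
      v ord_max z (w j)) = psi_mu (fun j => v (w j)).
    congr psi_mu; apply/funext => j; rewrite eqtype.dfwith_out //.
    by rewrite eq_sym -val_eqE /= neq_ltn ltn_ord.
  rewrite !S !E !eqtype.dfwith_in; exact: blin'.
have lti : (i < n.+1)%N by rewrite ltn_neqAle -ltnS ltn_ord andbT.
have -> : i = w (Ordinal lti) by apply: val_inj.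
set j := Ordinal lti.
have E z : (fun j' => @eqtype.dfwith _ (fun=> A : lmodType K)
    v (w j) z (w j')) = @eqtype.dfwith _ (fun=> A : lmodType K)
      (fun j => v (w j)) j z.
  apply/funext => j'.
  have [<-|nj] := eqVneq j j'; first by rewrite !eqtype.dfwith_in.
  by rewrite !eqtype.dfwith_out.
have F z : @eqtype.dfwith _ (fun=> A : lmodType K) v (w j) z ord_max
    = v ord_max.
  by rewrite eqtype.dfwith_out // -val_eqE /= ltn_eqF.
rewrite !S !E !F IHn; exact: blin.
Qed.

Definition psi_endo n : Endo A n := MkEndo (psi_mu_multilinear n).

Definition psi_fun n (x : As K n) : Endo A n := as_coef x *: psi_endo n.

Fact psi_linear n : linear (@psi_fun n).
Proof. by move=> a x y; rewrite /psi_fun linearP /= scalerDl scalerA. Qed.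

HB.instance Definition _ n := GRing.isLinear.Build K (As K n) (Endo A n) *:%R
  (@psi_fun n) (@psi_linear n).

Definition Psi n : {linear As K n -> Endo A n} := @psi_fun n.

End InducedStructure.

(* Main.v *)
Require Import Defs.
From mathcomp Require Import all_boot all_order all_algebra.
From mathcomp Require Import boolp functions.

Set Implicit Arguments.
Unset Strict Implicit.
Unset Printing Implicit Defensive.

Import GRing.Theory.
Local Open Scope ring_scope.

(** Since mu_(p+q) = mu_2 o (mu_p, mu_q), in an As-algebra the operation of
    mu_(p+q) is the product, under the operation of mu_2, of those of mu_p and
    mu_q. For (p, q) = (1, 2) and (2, 1) this is associativity; for (n, 1) it
    is the recursion defining the induced structure, so the operation of mu_2
    determines the whole action. Conversely the iterated products of an
    associative algebra respect the composition of As by generalized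
    associativity. *)

(** * Equality of functors *)

Lemma existT_inj (T : Type) (P : T -> Type) (x : T) (a b : P x) :
  existT P x a = existT P x b -> a = b.
Proof.
move=> E; have := projT2_eq E.
by rewrite (Prop_irrelevance (projT1_eq E) erefl).
Qed.

(* An arrow is packed with its end points, so that arrows between
   propositionally equal objects can be compared. *)
Definition sigma_hom (C : category) (X Y : C) (f : Defs.hom X Y) :
  {p : C * C & Defs.hom p.1 p.2} :=
  existT (fun p : C * C => Defs.hom p.1 p.2) (X, Y) f.

(** Comparing packed arrows avoids a transport along the equality of the object maps. The packed
    identities yield that equality; once it is eliminated, [existT_inj] unpacks the other arrows. *)
Lemma functor_ext (C D : category) (F G : functor C D) :
  (forall (X Y : C) (f : Defs.hom X Y),
     sigma_hom (fmap F f) = sigma_hom (fmap G f)) -> F = G.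
Proof.
case: F G => [F fF F1 FM] [G fG G1 GM] /= E.
have EFG : F = G.
  by apply/funext => X; have /(congr1 (fun s => (projT1 s).1)) := E _ _ (idm X).
case: _ / EFG fG G1 GM E => fG G1 GM E.
have EfFG : fF = fG.
  apply: functional_extensionality_dep => X.
  apply: functional_extensionality_dep => Y.
  by apply: functional_extensionality_dep => f; apply: (existT_inj (E X Y f)).
case: _ / EfFG G1 GM {E} => G1 GM.
by rewrite (Prop_irrelevance F1 G1) (Prop_irrelevance FM GM).
Qed.

(** * Binary operations and bilinear products *)

Section Bilinear.
Variables (K : fieldType) (V : lmodType K) (f : Endo V 2).

Lemma tnth_pairE (T : Type) (x y : T) (i : 'I_2) :
  tnth [tuple x; y] i = if i == ord0 then x else y.
Proof. by case: i => [[|[|]]]. Qed.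

Lemma endo_mulE (v : 'I_2 -> V) : f v = endo_mul f (v ord0) (v ord_max).
Proof.
congr (Endo_fun f _); apply/funext => i; rewrite tnth_pairE.
have [->//|ni] := eqVneq i ord0; congr v; apply: val_inj.
by case: i ni => [[|[|]]].
Qed.

Lemma endo_mul_bilinear : bilinear_for *:%R *:%R (endo_mul f).
Proof.
have /asboolP fP := Endo_multilinear f.
(* The constant family at [u] freezes the argument that does not vary. *)
split=> u a x y; [have := fP (fun=> u) ord0 a x y
                 |have := fP (fun=> u) ord_max a x y];
  by rewrite !endo_mulE !eqtype.dfwith_in !eqtype.dfwith_out.
Qed.

End Bilinear.

Lemma psi_muS (K : fieldType) (A : assoc_alg K) n (v : 'I_n.+2 -> A) :
  psi_mu v =
  assoc_mul (psi_mu (fun i => v (widen_ord (leqnSn n.+1) i))) (v ord_max).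
Proof. by []. Qed.

(** * From As-algebras to associative algebras *)

Section AsAlgebra.
Variables (K : fieldType) (X : palg (As K)).

(** The arity is a variable [n] with an equation [E], because the arity of a composite, a sum over
    ['I_2], is only provably [p + q]. *)
Lemma palg_act_mu_add p q n (E : (p + q)%N = n) (v : 'I_n -> X) :
  (0 < p)%N -> (0 < q)%N ->
  palg_act X n (as_mu K n) v =
  endo_mul (palg_act X 2 (as_mu K 2))
    (palg_act X p (as_mu K p) (fun i => v (cast_ord E (lshift q i))))
    (palg_act X q (as_mu K q) (fun i => v (cast_ord E (rshift p i)))).
Proof.
move=> p0 q0; pose k (i : 'I_2) := if i == ord0 then p else q.
have sumk : (\sum_i k i)%N = n by rewrite !big_ord_recl big_ord0 /= addn0.
(* With [n] replaced by this sum, the composite has the required type without transport. *)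
case: _ / sumk E v => E v.
have k0 i : (0 < k i)%N by rewrite /k; case: ifP.
have := palg_actM (palgP X) (as_mu K 2) (fun i => as_mu K (k i)).
rewrite /= as_comp_mu // => ->.
rewrite /endo_comp /= /endo_comp_fun endo_mulE; congr (endo_mul _ _ _).
  congr (Endo_fun _ _); apply/funext => j; congr v; apply: ord_inj.
  by rewrite tagnat.RankEsum [X in (X + _)%N]big_pred0.
congr (Endo_fun _ _); apply/funext => j; congr v; apply: ord_inj.
(* Only the first block, of length [p], precedes the second one. *)
rewrite tagnat.RankEsum [X in (X + _)%N]big_mkcond.
rewrite [X in (X + _)%N]big_ord_recl [X in (_ + X + _)%N]big_ord_recl.
by rewrite big_ord0 /= !addn0.
Qed.

(** As(0) = 0, so mu_0 is the zero vector. *)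
Lemma palg_act_mu0 : palg_act X 0 (as_mu K 0) = 0.
Proof. by rewrite -[as_mu K 0]as_coefK as_coef0 // scale0r linear0. Qed.

Lemma palg_act_mu1 (v : 'I_1 -> X) : palg_act X 1 (as_mu K 1) v = v ord0.
Proof. by have := palg_act1 (palgP X) => /= ->. Qed.

Lemma endo_mul_mu2A : associative (endo_mul (palg_act X 2 (as_mu K 2))).
Proof.
move=> x y z; pose v := tnth [tuple x; y; z].
have := palg_act_mu_add (erefl : (1 + 2)%N = 3) v isT isT.
rewrite (palg_act_mu_add (erefl : (2 + 1)%N = 3) v) // !palg_act_mu1.
by rewrite !endo_mulE => /esym.
Qed.

Definition as_assoc_data : assoc_data K :=
  AssocData (endo_mul (palg_act X 2 (as_mu K 2))).

Definition as_assoc_alg : assoc_alg K :=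
  @AssocAlg K as_assoc_data
    (@IsAssoc K as_assoc_data (endo_mul_bilinear _) endo_mul_mu2A).

Lemma psi_mu_palg_act n (v : 'I_n -> X) :
  @psi_mu K as_assoc_alg n v = palg_act X n (as_mu K n) v.
Proof.
elim: n v => [|[|n] IHn] v.
- by rewrite palg_act_mu0.
- by rewrite palg_act_mu1 /= (ord1 ord_max).
rewrite (palg_act_mu_add (addn1 n.+1)) // palg_act_mu1.
rewrite psi_muS IHn; congr (endo_mul _ (Endo_fun _ _) (v _)); last first.
  by apply: ord_inj; rewrite /= addn0.
by apply/funext => i; congr v; apply: ord_inj.
Qed.

(** Since mu_n spans As(n), linearity reduces the claim to mu_n. *)
Lemma Psi_palg_act : Psi as_assoc_alg = palg_act X.
Proof.
apply: functional_extensionality_dep => n; apply: linear_map_ext.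
apply/funext => x; rewrite -{2}[x]as_coefK linearZ; congr (_ *: _).
by apply: val_inj; apply/funext => v; apply: psi_mu_palg_act.
Qed.

End AsAlgebra.

Lemma palg_hom_mul (K : fieldType) (X Y : palg (As K)) (f : palg_hom X Y) :
  {morph f : x y / endo_mul (palg_act X 2 (as_mu K 2)) x y >->
                   endo_mul (palg_act Y 2 (as_mu K 2)) x y}.
Proof. by move=> x y; rewrite /endo_mul palg_mapP !endo_mulE. Qed.

(** * From associative algebras to As-algebras *)

Section InducedAsAlgebra.
Variables (K : fieldType) (A : assoc_alg K).

Lemma assoc_mulZ a b (x y : A) :
  assoc_mul (a *: x) (b *: y) = (a * b) *: assoc_mul x y.
Proof.
have [[mulZl mulZr] _] := assocP A.
(* Linearity reads m(a x + y) = a m(x) + m(y). At a = -1, x = y = 0 it gives m(0) = 0; homogeneity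
   is then the case y = 0. *)
have l0 u : assoc_mul (0 : A) u = 0.
  by have /= := mulZl u (-1) 0 0; rewrite scaler0 addr0 scaleN1r addNr.
have r0 u : assoc_mul u (0 : A) = 0.
  by have /= := mulZr u (-1) 0 0; rewrite scaler0 addr0 scaleN1r addNr.
have /= := mulZl (b *: y) a x 0; rewrite !addr0 => ->.
have /= := mulZr x b y 0; rewrite !addr0 => ->.
by rewrite l0 r0 !addr0 scalerA.
Qed.

(** This extracts the coordinates of the inner operations of a composite. In arity 0 both sides
    vanish, although the empty product is 1. *)
Lemma psi_muZ n (c : 'I_n -> K) (v : 'I_n -> A) :
  psi_mu (fun i => c i *: v i) = (\prod_i c i) *: psi_mu v.
Proof.
elim: n c v => [|[|n] IHn] c v; first by rewrite scaler0.
  by rewrite big_ord1 /= (ord1 ord_max).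
by rewrite big_ord_recr !psi_muS IHn assoc_mulZ.
Qed.

(* Indexing the factors by [nat] instead of ['I_n] avoids casts between
   ordinals of provably equal bounds. *)
Lemma psi_mu_add p q (w : nat -> A) : (0 < p)%N -> (0 < q)%N ->
  psi_mu (fun i : 'I_(p + q) => w i) =
  assoc_mul (psi_mu (fun i : 'I_p => w i))
            (psi_mu (fun i : 'I_q => w (p + i)%N)).
Proof.
case: p q => // p [//|q] _ _; elim: q => [|q IHq].
  by rewrite addn1 /= addn0.
(* Peel off the last factor: the induction hypothesis splits the rest, and associativity moves this
   factor into the second product. *)
rewrite addnS; transitivity
  (assoc_mul (psi_mu (fun i : 'I_(p.+1 + q.+1) => w i)) (w (p.+1 + q.+1)%N)).
  by rewrite addnS.
by rewrite IHq -(assoc_mulA (assocP A)).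
Qed.

(** Generalized associativity, by induction on the number of blocks: [psi_mu_add] splits off the
    last one. *)
Lemma psi_mu_sum n (k : nat -> nat) (w : nat -> A) :
  (0 < n)%N -> (forall i, 0 < k i)%N ->
  psi_mu (fun s : 'I_(\sum_(i < n) k i) => w s) =
  psi_mu (fun i : 'I_n =>
    psi_mu (fun j : 'I_(k i) => w (\sum_(i' < i) k i' + j)%N)).
Proof.
move=> n0 k0; case: n n0 => // n _; elim: n => [|n IHn].
  by rewrite big_ord1 /= big_ord0.
rewrite big_ord_recr psi_mu_add //; last first.
  by rewrite big_ord_recr /= addn_gt0 k0 orbT.
by rewrite IHn.
Qed.

Lemma psi_mu_comp n (k : 'I_n -> nat) (v : 'I_(\sum_i k i) -> A) :
  (0 < n)%N -> (forall i, 0 < k i)%N ->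
  psi_mu v = psi_mu (fun i => psi_mu (fun j => v (tagnat.Rank i j))).
Proof.
case: n k v => // n k v _ k0.
(* To apply [psi_mu_sum], [k] and [v] are extended to [nat]. The default position [s0] exists
   because the first block is nonempty. *)
pose s0 := tagnat.Rank ord0 (Ordinal (k0 ord0)).
pose k' m := k (inord m); pose w m := v (insubd s0 m).
have vE : v = (fun s => w s) by apply/funext => s; rewrite /w valKd.
have kE (i : 'I_n.+1) : k' i = k i by rewrite /k' inord_val.
have sumE : (\sum_i k i = \sum_(i < n.+1) k' i)%N.
  by apply: eq_bigr => i _; rewrite kE.
(* As [w] lives on [nat], the bound can be abstracted as [m] and rewritten without a cast. *)
rewrite vE (congr1 (fun m => psi_mu (fun s : 'I_m => w s)) sumE).
rewrite psi_mu_sum // => [|i]; last exact: k0.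
congr psi_mu; apply/funext => i.
pose S := (\sum_(i' < i) k' i')%N.
rewrite (congr1 (fun m => psi_mu (fun j : 'I_m => w (S + j)%N)) (kE i)).
congr psi_mu; apply/funext => j; rewrite /w; congr (v (insubd _ _)).
rewrite tagnat.RankEsum /S; congr (_ + _)%N.
rewrite (big_ord_widen n.+1 k'); last exact: ltnW.
by apply: eq_bigr => i' _; rewrite kE.
Qed.

Lemma psi_funE n (x : As K n) (v : 'I_n -> A) :
  psi_fun A x v = as_coef x *: psi_mu v.
Proof. by []. Qed.

Lemma Psi_is_palg : is_palg (PAlgData (Psi A)).
Proof.
split=> [n k th ths|]; apply: val_inj; last first.
  apply/funext => v; apply: etrans (psi_funE _ _) _.
  by rewrite as_coef_mu scale1r /= (ord1 ord_max).
apply/funext => v; apply: etrans (psi_funE _ _) _.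
transitivity (as_coef th *: psi_mu (fun i =>
    as_coef (ths i) *: psi_mu (fun j => v (tagnat.Rank i j)))); last by [].
rewrite as_coef_comp psi_muZ scalerA.
(* Both sides now carry the same scalar. It vanishes if [n] or some [k i] is 0, as As(0) = 0;
   otherwise [psi_mu_comp] applies. *)
have [n0|n0] := posnP n; first by rewrite (as_coef0 _ n0) !mul0r !scale0r.
have [/forallP k0|/forallPn[i]] := boolP [forall i, 0 < k i]%N.
  by rewrite -psi_mu_comp.
rewrite lt0n negbK => /eqP ki0; rewrite (bigD1 i) //= (as_coef0 _ ki0).
by rewrite mul0r mulr0 !scale0r.
Qed.

Definition Psi_palg : palg (As K) := PAlg Psi_is_palg.

Lemma endo_mul_Psi : endo_mul (Psi A 2 (as_mu K 2)) = @assoc_mul K A.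
Proof.
apply/funext => x; apply/funext => y.
by rewrite /endo_mul psi_funE as_coef_mu scale1r.
Qed.

End InducedAsAlgebra.

Lemma assoc_hom_psi (K : fieldType) (A B : assoc_alg K) (g : assoc_hom A B)
    n (v : 'I_n -> A) : g (psi_mu v) = psi_mu (fun i => g (v i)).
Proof.
elim: n v => [|[|n] IHn] v //; first exact: linear0.
by rewrite !psi_muS assoc_mapP IHn.
Qed.

Lemma assoc_hom_Psi (K : fieldType) (A B : assoc_alg K) (g : assoc_hom A B)
    n (mu : As K n) (v : 'I_n -> A) :
  g (Psi A n mu v) = Psi B n mu (fun i => g (v i)).
Proof. by rewrite !psi_funE linearZ /= assoc_hom_psi. Qed.

(** * The two functors and their composites *)

Section Functors.
Variable K : fieldType.

Definition as_assoc_hom (X Y : palg (As K)) (f : palg_hom X Y) :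
  assoc_hom (as_assoc_alg X) (as_assoc_alg Y) :=
  @AssocHom K (as_assoc_alg X) (as_assoc_alg Y) f (palg_hom_mul f).

Definition Psi_hom (A B : assoc_alg K) (g : assoc_hom A B) :
  palg_hom (Psi_palg A) (Psi_palg B) :=
  @PAlgHom K (As K) (Psi_palg A) (Psi_palg B) g (assoc_hom_Psi g).

Definition forget_functor : functor (Alg (As K)) (AssocAlgebras K).
Proof.
refine (@Functor (Alg (As K)) (AssocAlgebras K)
  (@as_assoc_alg K) as_assoc_hom _ _).
- by move=> X; apply: assoc_hom_ext.
- by move=> X Y Z g f; apply: assoc_hom_ext.
Defined.

Definition induced_functor : functor (AssocAlgebras K) (Alg (As K)).
Proof.
refine (@Functor (AssocAlgebras K) (Alg (As K))
  (@Psi_palg K) Psi_hom _ _).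
- by move=> X; apply: palg_hom_ext.
- by move=> X Y Z g f; apply: palg_hom_ext.
Defined.

(** Both composites of the functors keep carriers and linear maps, so only the structures on fixed
    [V] and [W] need comparing. Taking the actions as variables lets their equalities be
    eliminated. *)
Lemma sigma_palg_hom (V W : lmodType K)
    (actV actV' : forall n, {linear As K n -> Endo V n})
    (actW actW' : forall n, {linear As K n -> Endo W n})
    (PV : is_palg (PAlgData actV)) (PV' : is_palg (PAlgData actV'))
    (PW : is_palg (PAlgData actW)) (PW' : is_palg (PAlgData actW'))
    (f : palg_hom (PAlg PV) (PAlg PW)) (f' : palg_hom (PAlg PV') (PAlg PW')) :
  actV = actV' -> actW = actW' -> palg_map f = palg_map f' ->
  @sigma_hom (Alg (As K)) _ _ f = @sigma_hom (Alg (As K)) _ _ f'.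
Proof.
move=> EV EW; case: _ / EV PV' f' => PV' f'; case: _ / EW PW' f' => PW'.
rewrite (Prop_irrelevance PV' PV) (Prop_irrelevance PW' PW) => f' E.
by congr sigma_hom; apply: palg_hom_ext; rewrite E.
Qed.

Lemma sigma_assoc_hom (V W : lmodType K) (mulV mulV' : V -> V -> V)
    (mulW mulW' : W -> W -> W)
    (PV : is_assoc (AssocData mulV)) (PV' : is_assoc (AssocData mulV'))
    (PW : is_assoc (AssocData mulW)) (PW' : is_assoc (AssocData mulW'))
    (f : assoc_hom (AssocAlg PV) (AssocAlg PW))
    (f' : assoc_hom (AssocAlg PV') (AssocAlg PW')) :
  mulV = mulV' -> mulW = mulW' -> assoc_map f = assoc_map f' ->
  @sigma_hom (AssocAlgebras K) _ _ f = @sigma_hom (AssocAlgebras K) _ _ f'.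
Proof.
move=> EV EW; case: _ / EV PV' f' => PV' f'; case: _ / EW PW' f' => PW'.
rewrite (Prop_irrelevance PV' PV) (Prop_irrelevance PW' PW) => f' E.
by congr sigma_hom; apply: assoc_hom_ext; rewrite E.
Qed.

Lemma induced_forgetK :
  functor_comp induced_functor forget_functor = functor_id (Alg (As K)).
Proof.
apply: functor_ext => -[[V actV] PV] [[W actW] PW] f.
by apply: sigma_palg_hom => //; apply: (@Psi_palg_act K (PAlg _)).
Qed.

Lemma forget_inducedK :
  functor_comp forget_functor induced_functor = functor_id (AssocAlgebras K).
Proof.
apply: functor_ext => -[[V mulV] PV] [[W mulW] PW] f.
by apply: sigma_assoc_hom => //; apply: (@endo_mul_Psi K (AssocAlg _)).
Qed.

End Functors.

Theorem theorem3p24 (K : fieldType) (charK : [pchar K] =i pred0) :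
  exists (F : functor (Alg (As K)) (AssocAlgebras K))
         (G : functor (AssocAlgebras K) (Alg (As K))),
    (forall X : palg (As K),
       assoc_of (F X) = AssocData (endo_mul (palg_act X 2 (as_mu K 2)))) /\
    (forall (X Y : palg (As K)) (f : palg_hom X Y),
       LinearArrow (assoc_map (fmap F f)) = LinearArrow (palg_map f)) /\
    (forall A : assoc_alg K,
       palg_of (G A) = PAlgData (Psi A)) /\
    (forall (A B : assoc_alg K) (g : assoc_hom A B),
       LinearArrow (palg_map (fmap G g)) = LinearArrow (assoc_map g)) /\
    inverse_functors F G.
Proof.
(* The four descriptions of the functors hold by computation. *)
exists (forget_functor K), (induced_functor K); do 4![split=> //].
by split; [exact: induced_forgetK | exact: forget_inducedK].
Qed.
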